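(* For $n,k\ge0$ let $h(n,k)$ be the number of $k$-flats of $I(\mathfrak{gl}_n,V\oplus\bigwedge^2)$. Then, as formal power series, \[ H(s,t)=\sum_{n,k\ge0}h(n,k)s^nt^k=\frac{(1-s)(1-st+s^2t)}{1-2s+s^2-2st+3s^2t-2s^3t+s^2t^2-2s^3t^2+s^4t^2}. \]
   Context: Identify the diagonal Cartan subalgebra of $\mathfrak{gl}_n$ with $\mathbb{R}^n$ with coordinates $x_1,\dots,x_n$. Let $W=\{x_1\ge\cdots\ge x_n\}$ (closed Weyl chamber). For $1\le i\le j\le n$ let $\lambda_{i,j}^\perp$ be the hyperplane $x_i+x_j=0$ (for $i=j$: $x_i=0$); these are the kernels of the weights of $V\oplus\bigwedge^2V$ and $I(\mathfrak{gl}_n,V\oplus\bigwedge^2)$ is the arrangement of these hyperplanes restricted to $W$. A flat is a set of the form $W\cap\bigcap_{(i,j)\in T}\lambda_{i,j}^\perp$ for some (possibly empty) set $T$ of pairs $i\le j$ (the empty $T$ gives $W$); a $k$-flat is a flat whose linear span has dimension $k$. Distinct flats are counted as distinct subsets of $W$. *)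

(* Defs.v *)
From HB Require Import structures.
From mathcomp Require Import all_boot all_order all_algebra.
From mathcomp Require Import boolp classical_sets reals.
Set Implicit Arguments. Unset Strict Implicit. Unset Printing Implicit Defensive.
Import Order.TTheory GRing.Theory Num.Theory.
Local Open Scope ring_scope.
Local Open Scope classical_set_scope.

Section Arrangement.
Variables (R : realType) (n : nat).

(* Points of the Cartan subalgebra of gl_n, identified with R^n (row vectors);
   coordinate x_{i+1} is x 0 i. *)
Definition pt := 'rV[R]_n.

Definition weyl_chamber : set pt :=
  [set x | forall i j : 'I_n, (i <= j)%N -> x 0 j <= x 0 i].

Definition hyp (i j : 'I_n) : set pt :=
  [set x | if i == j then x 0 i = 0 else x 0 i + x 0 j = 0].

Definition admissible (T : {set 'I_n * 'I_n}) : bool :=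
  [forall p in T, (p.1 <= p.2)%N].

Definition flat_of (T : {set 'I_n * 'I_n}) : set pt :=
  weyl_chamber `&` [set x | forall p, p \in T -> hyp p.1 p.2 x].

Lemma span_dim_ex (S : set pt) :
  exists m, `[< exists U : {vspace pt}, (forall x, S x -> x \in U) /\ \dim U = m >].
Proof.
exists (\dim (fullv : {vspace pt})); apply/asboolP.
by exists fullv; split => // x _; rewrite memvf.
Qed.

Definition span_dim (S : set pt) : nat := ex_minn (span_dim_ex S).

Definition h (k : nat) : nat :=
  size (undup [seq flat_of T | T <- enum [set T : {set 'I_n * 'I_n} | admissible T]
                & span_dim (flat_of T) == k]).

End Arrangement.

(* Formal power series in two variables s, t with integer coefficients:
   f n k is the coefficient of s^n t^k. *)
Definition ps := nat -> nat -> int.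

Definition psmul (f g : ps) : ps := fun n k =>
  \sum_(a < n.+1) \sum_(b < k.+1) f a b * g (n - a)%N (k - b)%N.

Definition poly2 (l : seq (int * nat * nat)) : ps := fun n k =>
  \sum_(m <- l | (m.1.2 == n) && (m.2 == k)) m.1.1.

Definition num1 : ps := poly2 [:: (1, 0, 0); (-1, 1, 0)].
Definition num2 : ps := poly2 [:: (1, 0, 0); (-1, 1, 1); (1, 2, 1)].
Definition den : ps := poly2
  [:: (1, 0, 0); (-2, 1, 0); (1, 2, 0); (-2, 1, 1); (3, 2, 1); (-2, 3, 1);
      (1, 2, 2); (-2, 3, 2); (1, 4, 2)].

(* Main.v *)
(* A flat is determined by the set of vanishing x_i + x_j at a generic point of
   it, and every zero pattern of a point of the chamber arises; so k-flats are
   counted by zero patterns.  Let H count all patterns, F those where x_1 is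
   matched (x_1 + x_j = 0 for some j), G those with x_1 + x_n = 0, and K those
   which moreover have x_1 > x_2.  Peeling off an outer coordinate gives
     H = 1 + s t H + F,  F = s t F + G,  G = s G + s + K,  K = s K + s^2 t H:
   an unmatched end coordinate is free (s t), a repeated one is determined by its
   neighbour (s), and a simple pair x_1 = - x_n is one free parameter (s^2 t).
   Eliminating F, G and K yields the formula. *)
From HB Require Import structures.
Require Import Defs.
From mathcomp Require Import all_boot all_order all_algebra.
From mathcomp Require Import boolp classical_sets reals.
From mathcomp Require Import zify ring lra.
Set Implicit Arguments. Unset Strict Implicit. Unset Printing Implicit Defensive.
Import Order.TTheory GRing.Theory Num.Theory.
Local Open Scope ring_scope.

(** * Codes of points *)

(* A point x_0 >= ... >= x_(n-1) is read from outside to inside: [Lft], [Rgt]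
   delete an unmatched first or last coordinate, [DupL], [DupR] a repeated one,
   [Outer] a pair x_0 = - x_(n-1) of simple end values, and [Zero] is the
   one-coordinate point 0.  The function [code] sees only the zero pattern
   t i j <-> x_i + x_j = 0. *)
Inductive letter := Lft | Rgt | DupL | DupR | Zero | Outer.

Lemma letter_eq_dec : comparable letter.
Proof. by case; case; ((by left) || (by right)). Defined.

HB.instance Definition _ := hasDecEq.Build letter (compareP letter_eq_dec).

Fixpoint code n (t : rel nat) : seq letter :=
  if n is m.+1 then
    let t' := fun i j => t i.+1 j.+1 in
    if ~~ has (t 0%N) (iota 0 m.+1) then Lft :: code m t'
    else if ~~ has (t m) (iota 0 m.+1) then Rgt :: code m t
    else if m is p.+1 then
      if t 1%N m then DupL :: code m t'
      else if t 0%N p then DupR :: code m t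
      else Outer :: code p t'
    else [:: Zero]
  else [::].

Lemma codeS m (t : rel nat) (t' := fun i j => t i.+1 j.+1) :
  code m.+1 t =
    if ~~ has (t 0%N) (iota 0 m.+1) then Lft :: code m t'
    else if ~~ has (t m) (iota 0 m.+1) then Rgt :: code m t
    else if m is p.+1 then
      if t 1%N m then DupL :: code m t'
      else if t 0%N p then DupR :: code m t
      else Outer :: code p t'
    else [:: Zero].
Proof. by []. Qed.

(** Inverse reading of [code], meaningful for indices below n. For [DupL] the truncated predecessor
    identifies the indices 0 and 1; for [DupR] the minimum identifies the last two. *)
Fixpoint decode (w : seq letter) n (i j : nat) : bool :=
  match w with
  | [::] => false
  | Lft :: w => [&& 0 < i, 0 < j & decode w n.-1 i.-1 j.-1]%N
  | Rgt :: w => [&& i < n.-1, j < n.-1 & decode w n.-1 i j]%N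
  | DupL :: w => decode w n.-1 i.-1 j.-1
  | DupR :: w => decode w n.-1 (minn i n.-2) (minn j n.-2)
  | Zero :: _ => true
  | Outer :: w => if [&& 0 < i < n.-1 & 0 < j < n.-1]%N
                 then decode w n.-2 i.-1 j.-1
                 else ((i == 0) && (j == n.-1) || (j == 0) && (i == n.-1))%N
  end.

Lemma eq_code n (t u : rel nat) :
  (forall i j, i < n -> j < n -> t i j = u i j)%N -> code n t = code n u.
Proof.
elim/ltn_ind: n t u => -[|m] IH t u tu //.
have hasE a : (a < m.+1)%N -> has (t a) (iota 0 m.+1) = has (u a) (iota 0 m.+1).
  by move=> am; apply: eq_in_has => j; rewrite mem_iota => /andP[_ jm]; exact: tu.
have e1 : code m (fun i j => t i.+1 j.+1) = code m (fun i j => u i.+1 j.+1).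
  by apply: IH => // i j im jm; apply: tu.
have e2 : code m t = code m u by apply: IH => // i j im jm; apply: tu; lia.
rewrite !codeS (hasE 0%N isT) (hasE m (ltnSn m)) e1 e2.
case: m tu IH {hasE e1 e2} => [|p] // tu IH.
by rewrite !tu// (IH p _ _ (fun i j => u i.+1 j.+1))// => i j ip jp; apply: tu; lia.
Qed.

Section Points.
Variable R : realFieldType.
Implicit Types x y : nat -> R.

Definition noninc n x := forall i j, (i <= j)%N -> (j < n)%N -> x j <= x i.

Definition cancels x : rel nat := fun i j => x i + x j == 0.

Definition shift x : nat -> R := fun i => x i.+1.

Lemma cancelsC x i j : cancels x i j = cancels x j i.
Proof. by rewrite /cancels addrC. Qed.

Lemma noninc_shift n x : noninc n.+1 x -> noninc n (shift x).
Proof. by move=> xW i j ij jn; apply: xW. Qed.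

Lemma noninc_leq m n x : (m <= n)%N -> noninc n x -> noninc m x.
Proof. by move=> mn xW i j ij jm; apply: xW => //; lia. Qed.

(** Here n is the last index. The fixed order of the tests makes the code canonical, and each case
    keeps what the earlier tests leave: [CodeRgt] a partner of x_0 before index n, [CodeDupR] and
    [CodeOuter] the strict drop after x_0. *)
Variant code_spec n x : seq letter -> Prop :=
| CodeLft of (forall j, (j <= n)%N -> x 0%N + x j != 0) :
    code_spec n x (Lft :: code n (cancels (shift x)))
| CodeRgt i of (i < n)%N & x 0%N + x i = 0
    & (forall j, (j <= n)%N -> x n + x j != 0) :
    code_spec n x (Rgt :: code n (cancels x))
| CodeZero of n = 0%N & x 0%N = 0 : code_spec n x [:: Zero]
| CodeDupL m of n = m.+1 & x 0%N + x n = 0 & x 0%N = x 1%N :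
    code_spec n x (DupL :: code n (cancels (shift x)))
| CodeDupR m of n = m.+1 & x 0%N + x n = 0 & x 1%N < x 0%N & x n = x m :
    code_spec n x (DupR :: code n (cancels x))
| CodeOuter m of n = m.+1 & x 0%N + x n = 0 & x 1%N < x 0%N & x n < x m :
    code_spec n x (Outer :: code m (cancels (shift x))).

Lemma codeP n x : noninc n.+1 x -> code_spec n x (code n.+1 (cancels x)).
Proof.
move=> xW; rewrite codeS.
case: ifPn => [H0|/negPn/hasP[i]].
  by apply: CodeLft => j jn; apply: (@hasPn _ _ (iota 0 n.+1) H0); rewrite mem_iota; lia.
rewrite mem_iota => /andP[_ iln] /eqP xi.
case: ifPn => [Hn|/negPn/hasP[j]].
  have Hn' : forall j, (j <= n)%N -> x n + x j != 0.
    by move=> j jn; apply: (@hasPn _ _ (iota 0 n.+1) Hn); rewrite mem_iota; lia.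
  apply: (@CodeRgt _ _ i) => //.
  have: (i <= n)%N by []; rewrite leq_eqVlt => /orP[/eqP ein|//].
  by move: (Hn' 0%N isT); rewrite -ein addrC xi eqxx.
rewrite mem_iota => /andP[_ jln] /eqP xj.
(* With partners x_i of x_0 and x_j of x_n, monotonicity squeezes: x_0 + x_n <= x_0 + x_i = 0 and
   x_0 + x_n >= x_j + x_n = 0. *)
have x0n : x 0%N + x n = 0.
  have := xW i n _ (ltnSn n); have := xW 0%N j isT jln; move: xi xj.
  by move=> ? ? ? /(_ iln); lra.
case: n xW x0n {iln jln xi xj} => [|m] xW x0n; first by apply: CodeZero => //; lra.
have x10 := xW 0%N 1%N isT isT; have xmm := xW m m.+1 (leqnSn m) (ltnSn _).
case: ifPn => [/eqP H1|H1]; first by apply: (@CodeDupL _ _ m) => //; lra.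
have x10' : x 1%N < x 0%N.
  by rewrite lt_neqAle x10 andbT; apply: contra H1 => /eqP e; apply/eqP; lra.
case: ifPn => [/eqP H2|H2]; first by apply: (@CodeDupR _ _ m) => //; lra.
apply: (@CodeOuter _ _ m) => //.
by rewrite lt_neqAle xmm andbT; apply: contra H2 => /eqP e; apply/eqP; lra.
Qed.

(** The letter forces the row of each deleted coordinate: empty if unmatched, a copy of its
    neighbour's if repeated, only the opposite end for an outer pair. So the code determines the
    zero pattern. *)
Lemma decode_code n x i j : noninc n x -> (i < n)%N -> (j < n)%N ->
  decode (code n (cancels x)) n i j = cancels x i j.
Proof.
elim/ltn_ind: n x i j => -[|n] IH x i j xW // iln jln.
have xS := noninc_shift xW; have xn := noninc_leq (leqnSn n) xW.
case: (codeP xW) => [H|i0 i0n x0i H|n0 x0|m nm x0n x01|m nm x0n x10 xnm|m nm x0n x10 xnm] /=.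
- case: i iln => [|i] iln /=; first by rewrite /cancels (negbTE (H _ _)).
  case: j jln => [|j] jln /=; first by rewrite /cancels addrC (negbTE (H _ _)).
  by rewrite IH.
- have [iln'|] := ltnP i n; last first.
    move=> ?; have -> : i = n by lia.
    by rewrite /cancels (negbTE (H _ _)).
  have [jln'|] := ltnP j n; last first.
    move=> ?; have -> : j = n by lia.
    by rewrite /cancels addrC (negbTE (H _ _)).
  by rewrite IH.
- have [-> ->] : i = 0%N /\ j = 0%N by lia.
  by rewrite /cancels x0 addr0 eqxx.
- have E k : shift x k.-1 = x k by case: k.
  by rewrite IH//; [rewrite /cancels !E|lia..].
- have E k : (k < n.+1)%N -> x (minn k n.-1) = x k.
    move=> kn; have [kn'|kn'] := eqVneq k n; last by congr x; lia.
    by rewrite kn' xnm; congr x; lia.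
  by rewrite IH//; [rewrite /cancels !E|lia..].
- have mn1 : (m < n.+1)%N by lia.
  case: ifPn => [/andP[ib jb]|ijb].
    have -> : n.-1 = m by lia.
    rewrite IH//; [|apply: noninc_leq xS; lia|lia..].
    by case: i j ib jb {iln jln} => [|i] [|j].
  (* Both end values are simple and opposite, so x_0 and x_n cancel each other and nothing else. *)
  have lt0 k : (0 < k <= n)%N -> x k < x 0%N.
    by move=> /andP[k0 kn]; apply: le_lt_trans x10; apply: xW.
  have gtn k : (k < n)%N -> x n < x k.
    by move=> kn; apply: (lt_le_trans xnm); apply: xW; lia.
  have aux a b : (a <= n)%N -> (b <= n)%N -> ~~ (0 < a < n)%N ->
      cancels x a b = ((a == 0) && (b == n) || (b == 0) && (a == n))%N.
    move=> an bn ab.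
    have {ab} [->|->] : a = 0%N \/ a = n by lia.
    - have -> : (0%N == n) = false by lia.
      rewrite eqxx andbF orbF /=; have [->|bn'] := eqVneq b n; first exact/eqP.
      have xnb : x n < x b by apply: gtn; lia.
      by rewrite /cancels; case: eqP => // e; move: xnb x0n e; clear; lra.
    have -> : (n == 0%N) = false by lia.
    rewrite eqxx andbT /=; have [->|bn'] := eqVneq b 0%N; first by rewrite /cancels addrC x0n eqxx.
    have xb0 : x b < x 0%N by apply: lt0; lia.
    by rewrite /cancels; case: eqP => // e; move: xb0 x0n e; clear; lra.
  rewrite negb_and in ijb; case/orP: ijb => ab.
    by rewrite aux.
  rewrite cancelsC aux// orbC [(i == 0%N) && _]andbC.
  by rewrite [(j == 0%N) && _]andbC andbC [X in _ || X]andbC.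
Qed.

End Points.

(** * The language of codes *)

(* The codes of length-n points: all of them (H), those whose first coordinate
   is matched (F), those with x_0 + x_(n-1) = 0 (G), and among the latter those
   with x_1 < x_0 (K).  [prev_words] keeps H for n - 1, since [Outer] removes two
   coordinates at once. *)
Record wordlists := WordLists {
  all_words : seq (seq letter);
  first_matched_words : seq (seq letter);
  ends_opp_words : seq (seq letter);
  strict_ends_words : seq (seq letter);
  prev_words : seq (seq letter) }.

(** The word [Zero] enters only at length one. The previous list starts empty, so [Outer] first
    occurs at length two. *)
Fixpoint words n : wordlists :=
  if n is m.+1 then
    let: WordLists H F G K P := words m in
    let K' := map (cons DupR) K ++ map (cons Outer) P in
    let G' := map (cons DupL) G ++ nseq (m == 0%N) [:: Zero] ++ K' in
    let F' := map (cons Rgt) F ++ G' in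
    WordLists (map (cons Lft) H ++ F') F' G' K' H
  else WordLists [:: [::]] [::] [::] [::] [::].

Definition wH n := all_words (words n).
Definition wF n := first_matched_words (words n).
Definition wG n := ends_opp_words (words n).
Definition wK n := strict_ends_words (words n).

Lemma wHS n : wH n.+1 = map (cons Lft) (wH n) ++ wF n.+1.
Proof. by rewrite /wH /wF /=; case: (words n). Qed.

Lemma wFS n : wF n.+1 = map (cons Rgt) (wF n) ++ wG n.+1.
Proof. by rewrite /wG /wF /=; case: (words n). Qed.

Lemma wGS n : wG n.+1 = map (cons DupL) (wG n) ++ nseq (n == 0%N) [:: Zero] ++ wK n.+1.
Proof. by rewrite /wG /wK /=; case: (words n). Qed.

Lemma wKSS n : wK n.+2 = map (cons DupR) (wK n.+1) ++ map (cons Outer) (wH n).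
Proof. by rewrite /wH /wK /=; case: (words n). Qed.

Lemma mem_map_cons (a b : letter) (w : seq letter) (s : seq (seq letter)) :
  (b :: w \in map (cons a) s) = (a == b) && (w \in s).
Proof.
apply/mapP/andP => [[u us [-> ->]]//|[/eqP-> ws]]; by exists w.
Qed.

Lemma nil_map_cons (a : letter) (s : seq (seq letter)) :
  ([::] \in map (cons a) s) = false.
Proof. by apply/mapP => -[]. Qed.

Definition mem_wordE := (mem_map_cons, nil_map_cons, mem_cat, mem_nseq).

(** The concatenated pieces differ in their first letter: [DupR] and [Outer] in K, then [DupL] and
    [Zero] in G, [Rgt] in F, [Lft] in H. *)
Lemma uniq_words n : [/\ uniq (wH n), uniq (wF n), uniq (wG n) & uniq (wK n)].
Proof.
have uM a (s : seq (seq letter)) : uniq s -> uniq (map (cons a) s).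
  by rewrite map_inj_uniq// => ? ? [].
have cat2 (s t : seq (seq letter)) :
    uniq s -> uniq t -> (forall w, w \in t -> w \notin s) -> uniq (s ++ t).
  by move=> us ut st; rewrite cat_uniq us ut andbT; apply/hasPn.
elim/ltn_ind: n => -[|n] IH //.
have [uH uF uG uK] := IH n (ltnSn n).
have uK' : uniq (wK n.+1).
  case: n IH {uH uF uG} uK => [|n] IH uK //.
  have [uH _ _ _] := IH n (leqnSn _).
  rewrite wKSS; apply: (cat2); [by auto|by auto|].
  by move=> w /mapP[u _ ->]; rewrite mem_map_cons.
have hK a w : a \notin [:: DupR; Outer] -> (a :: w \in wK n.+1) = false.
  case: n {IH uH uF uG uK uK'} => // n; rewrite wKSS !inE.
  by rewrite !mem_wordE; case: a.
have uG' : uniq (wG n.+1).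
  rewrite wGS; apply: (cat2); [by auto| |]; last first.
    move=> w; rewrite mem_cat => wP; apply/negP => /mapP[u _ wE].
    by move: wP; rewrite wE hK// mem_nseq orbF => /andP[].
  apply: (cat2) => //; first by case: (n).
  move=> w wP; apply/negP; rewrite mem_nseq => /andP[_ /eqP wE].
  by rewrite wE hK in wP.
have hG a w : a \notin [:: DupR; Outer; DupL; Zero] -> (a :: w \in wG n.+1) = false.
  rewrite !inE wGS !mem_wordE => aP; rewrite hK; last by rewrite !inE; case: a aP.
  by rewrite orbF; case: a aP => //= _; rewrite andbF.
have uF' : uniq (wF n.+1).
  rewrite wFS; apply: (cat2); [by auto|by auto|].
  move=> w wP; apply/negP => /mapP[u _ wE].
  by move: wP; rewrite wE hG.
split => //; rewrite wHS; apply: (cat2); [by auto|by auto|].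
move=> w wP; apply/negP => /mapP[u _ wE].
by move: wP; rewrite wE wFS !mem_wordE hG.
Qed.

(** * Codes of points belong to the word lists *)

Section Realize.
Variable R : realFieldType.
Implicit Types x y : nat -> R.

Definition first_matched n x := exists2 i, (i < n)%N & x 0%N + x i = 0.
Definition ends_opp n x := (0 < n)%N /\ x 0%N + x n.-1 = 0.
Definition strict_ends n x := [/\ (1 < n)%N, x 0%N + x n.-1 = 0 & x 1%N < x 0%N].

Lemma strict_ends_opp n x : strict_ends n x -> ends_opp n x.
Proof. by case=> n1 xn _; split=> //; lia. Qed.

Lemma ends_opp_matched n x : ends_opp n x -> first_matched n x.
Proof. by case=> n0 xn; exists n.-1; first lia. Qed.

(** The induction must treat the four classes together: removing an unmatched last coordinate keeps
    x_0 matched, removing a repeated first one keeps the ends opposite, and [DupR] also keeps x_1 <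
    x_0. After [Lft] or [Outer] the rest is arbitrary. *)
Lemma mem_code n x : noninc n x ->
  [/\ code n (cancels x) \in wH n,
      first_matched n x -> code n (cancels x) \in wF n,
      ends_opp n x -> code n (cancels x) \in wG n &
      strict_ends n x -> code n (cancels x) \in wK n].
Proof.
elim/ltn_ind: n x => -[|n] IH x xW.
  split=> //; [by case|by case|by case].
have xS := noninc_shift xW; have xn := noninc_leq (leqnSn n) xW.
have FH w : w \in wF n.+1 -> w \in wH n.+1 by rewrite wHS mem_cat => ->; rewrite orbT.
have GF w : w \in wG n.+1 -> w \in wF n.+1 by rewrite wFS mem_cat => ->; rewrite orbT.
have KG w : w \in wK n.+1 -> w \in wG n.+1 by rewrite wGS !mem_cat => ->; rewrite !orbT.
have of_wG w : w \in wG n.+1 -> (strict_ends n.+1 x -> w \in wK n.+1) ->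
    [/\ w \in wH n.+1, first_matched n.+1 x -> w \in wF n.+1,
        ends_opp n.+1 x -> w \in wG n.+1 & strict_ends n.+1 x -> w \in wK n.+1].
  by move=> wG wK; split => // [|_]; [apply/FH/GF|apply/GF].
case: (codeP xW) => [H|i0 i0n x0i H|n0 x0|m nm x0n x01|m nm x0n x10 xnm|m nm x0n x10 xnm] /=.
- have NF : ~ first_matched n.+1 x by case=> j jn /eqP; rewrite (negbTE (H _ _)).
  split=> [|/NF//|/ends_opp_matched/NF//|/strict_ends_opp/ends_opp_matched/NF//].
  by have [wP _ _ _] := IH n (ltnSn n) _ xS; rewrite wHS !mem_wordE wP.
- have NG : ~ ends_opp n.+1 x by case=> _ /=; rewrite addrC => /eqP; rewrite (negbTE (H _ _)).
  have wP : Rgt :: code n (cancels x) \in wF n.+1.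
    by rewrite wFS !mem_wordE; have [_ ->//] := IH n (ltnSn n) _ xn; exists i0.
  by split=> [|//|/NG//|/strict_ends_opp/NG//]; exact: FH.
- apply: of_wG; first by rewrite wGS n0 !mem_wordE.
  by rewrite n0 => -[].
- apply: of_wG; last by case=> _ _; rewrite x01 ltxx.
  rewrite wGS mem_cat mem_map_cons eqxx.
  have [_ _ ->//] := IH n (ltnSn n) _ xS.
  by rewrite nm in x0n *; split => //; rewrite /shift/= -x01.
- have wP : DupR :: code n (cancels x) \in wK n.+1.
    rewrite nm wKSS mem_cat mem_map_cons eqxx -nm.
    have [_ _ _ ->//] := IH n (ltnSn n) _ xn.
    split=> //; last by rewrite nm/= -xnm.
    (* For m = 0 the two equal last coordinates would be x_0 and x_1, against x_1 < x_0. *)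
    case: m nm xnm => [nm xnm|m ->//]; move: x0n x10; rewrite nm in xnm *.
    by rewrite xnm; move: (x 0%N) (x 1%N) xnm => a b; lra.
  by apply: of_wG => //; exact: KG.
- have wP : Outer :: code m (cancels (shift x)) \in wK n.+1.
    rewrite nm wKSS mem_cat mem_map_cons [X in _ || X]mem_map_cons eqxx /=.
    have mn : (m < n.+1)%N by lia.
    have xm : noninc m (shift x) by apply: noninc_leq xS; lia.
    by have [->//] := IH m mn _ xm.
  by apply: of_wG => //; exact: KG.
Qed.

End Realize.

(** These three letters each bring one free parameter; by [flat_basis] the count is the dimension of
    the span of the flat. *)
Definition wdim (w : seq letter) := count (mem [:: Lft; Rgt; Outer]) w.

(** * Every word is the code of a point *)

Section Realization.
Variable R : realFieldType.
Implicit Types x y : nat -> R.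

Definition push (a : R) x : nat -> R := fun i => if i is j.+1 then x j else a.

Definition set_last n x (a : R) : nat -> R := fun i => if (i < n)%N then x i else a.

(** In a nonincreasing sequence the extreme values sit at the ends, so this dominates every |x_j|
    with j < n. *)
Definition bound n x : R := `|x 0%N| + `|x n.-1|.

Lemma boundP n x j : noninc n x -> (j < n)%N -> - bound n x <= x j <= bound n x.
Proof.
move=> xW jn; rewrite /bound.
have h0 := xW 0%N j isT jn.
have h1 : x n.-1 <= x j by apply: xW; lia.
have := ler_norm (x 0%N); have := ler_norm (- x n.-1); rewrite normrN.
have := normr_ge0 (x 0%N); have := normr_ge0 (x n.-1).
move: h0 h1; clear; move=> h0 h1 h2 h3 h4 h5; apply/andP; split; lra.
Qed.

Lemma bound_ge0 n x : 0 <= bound n x.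
Proof. by rewrite addr_ge0. Qed.

Lemma noninc_push n x a : noninc n x -> bound n x <= a -> noninc n.+1 (push a x).
Proof.
move=> xW xa [|i] [|j] //= ij jn; last exact: xW.
by have /andP[_] := boundP xW jn; move=> /le_trans; apply.
Qed.

Lemma noninc_set_last n x a : noninc n x -> a <= - bound n x -> noninc n.+1 (set_last n x a).
Proof.
move=> xW xa i j ij; rewrite ltnS leq_eqVlt /set_last => /orP[/eqP->|jn].
  rewrite ltnn; case: ifP => // jn.
  by have /andP[+ _] := boundP xW jn; apply: le_trans.
by rewrite (leq_ltn_trans ij jn) jn; exact: xW.
Qed.

Lemma noninc_dupl n x : noninc n x -> noninc n.+1 (x \o predn).
Proof.
move=> xW i [|j]/= ij jn; first by have -> : i = 0%N by lia.
by apply: xW; lia.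
Qed.

Lemma noninc_dupr n x : (0 < n)%N -> noninc n x ->
  noninc n.+1 (fun i => x (minn i n.-1)).
Proof. by move=> n0 xW i j ij jn; apply: xW; lia. Qed.

(** Here and in the next four lemmas the hypotheses contradict all cases of [code_spec] but one;
    they compute the codes of the points built in [code_realized]. *)
Lemma code_lft n x : noninc n.+1 x -> (forall j, (j <= n)%N -> x 0%N + x j != 0) ->
  code n.+1 (cancels x) = Lft :: code n (cancels (shift x)).
Proof.
move=> xW H; have /negbTE Hn := H n (leqnn n).
case: (codeP xW) => [//|i /ltnW/H/negbTE i_n /eqP|_ x0|m _ /eqP|m _ /eqP|m _ /eqP];
  rewrite ?Hn ?i_n//.
by move: (H 0%N isT); rewrite x0 addr0 eqxx.
Qed.

Lemma code_rgt n x : noninc n.+1 x -> first_matched n x ->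
  (forall j, (j <= n)%N -> x n + x j != 0) ->
  code n.+1 (cancels x) = Rgt :: code n (cancels x).
Proof.
move=> xW [i0 i0n xi0] H; have Hn : x 0%N + x n != 0 by rewrite addrC H.
case: (codeP xW) => [H'|//|n0 _|m _ /eqP|m _ /eqP|m _ /eqP]; rewrite ?(negbTE Hn)//.
  by move: (H' i0 (ltnW i0n)); rewrite xi0 eqxx.
by rewrite n0 in i0n.
Qed.

Lemma code_dupl n x : noninc n.+2 x -> x 0%N + x n.+1 = 0 -> x 0%N = x 1%N ->
  code n.+2 (cancels x) = DupL :: code n.+1 (cancels (shift x)).
Proof.
move=> xW xn x01; case: (codeP xW) => [H|i i_n xi H|//|//|m _ _|m _ _].
- by move: (H n.+1 (leqnn _)); rewrite xn eqxx.
- by move: (H 0%N isT); rewrite addrC xn eqxx.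
- by rewrite x01 ltxx.
- by rewrite x01 ltxx.
Qed.

Lemma code_dupr n x : noninc n.+2 x -> x 0%N + x n.+1 = 0 -> x 1%N < x 0%N ->
  x n.+1 = x n -> code n.+2 (cancels x) = DupR :: code n.+1 (cancels x).
Proof.
move=> xW xn x10 xnn; case: (codeP xW) => [H|i i_n xi H|//|m _ _ x01|//|m [<-] _ _].
- by move: (H n.+1 (leqnn _)); rewrite xn eqxx.
- by move: (H 0%N isT); rewrite addrC xn eqxx.
- by move: x10; rewrite x01 ltxx.
- by rewrite xnn ltxx.
Qed.

Lemma code_outer n x : noninc n.+2 x -> x 0%N + x n.+1 = 0 -> x 1%N < x 0%N ->
  x n.+1 < x n -> code n.+2 (cancels x) = Outer :: code n (cancels (shift x)).
Proof.
move=> xW xn x10 xnn; case: (codeP xW) => [H|i i_n xi H|//|m _ _ x01|m [<-] _ _ e|m [->]//].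
- by move: (H n.+1 (leqnn _)); rewrite xn eqxx.
- by move: (H 0%N isT); rewrite addrC xn eqxx.
- by move: x10; rewrite x01 ltxx.
- by move: xnn; rewrite e ltxx.
Qed.

(** Each letter is undone by an explicit extension of a point: a new end value beyond [bound] for
    [Lft] and [Rgt], a repeated end for [DupL] and [DupR], a surrounding opposite pair for
    [Outer]. *)
Lemma code_realized n :
  [/\ forall w, w \in wH n -> exists x, noninc n x /\ code n (cancels x) = w,
      forall w, w \in wF n ->
        exists x, [/\ noninc n x, first_matched n x & code n (cancels x) = w],
      forall w, w \in wG n ->
        exists x, [/\ noninc n x, ends_opp n x & code n (cancels x) = w] &
      forall w, w \in wK n ->
        exists x, [/\ noninc n x, strict_ends n x & code n (cancels x) = w]].
Proof.
elim/ltn_ind: n => -[|n] IH.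
  split=> // w; rewrite inE => /eqP->; exists (fun=> 0); split=> // i j _.
have [IH_H IH_F IH_G IH_K] := IH n (ltnSn n).
have HK w : w \in wK n.+1 ->
    exists x, [/\ noninc n.+1 x, strict_ends n.+1 x & code n.+1 (cancels x) = w].
  case: n IH IH_K {IH_H IH_F IH_G} => [//|n] IH IH_K.
  rewrite wKSS mem_cat => /orP[/mapP[u /IH_K[x [xW [n1 xn x10] <-] ->]]|/mapP[u uH ->]].
    have yW := noninc_dupr (ltn0Sn n) xW.
    set y := fun i => _ in yW; rewrite /= in xn n1.
    have y0 : y 0%N = x 0%N by rewrite /y min0n.
    have y1 : y 1%N = x 1%N by rewrite /y; congr x; lia.
    have yn : y n.+1 = x n by rewrite /y; congr x; lia.
    have ynn : y n = x n by rewrite /y; congr x; lia.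
    exists y; split=> //; first by split=> //; rewrite ?y0 ?y1 /= ?yn.
    rewrite code_dupr ?y0 ?y1 ?yn//; congr (_ :: _).
    by apply: eq_code => i j ilt jlt; congr (_ + _ == 0); rewrite /y; congr x; lia.
  have [/(_ u uH)[x [xW <-]] _ _ _] := IH n (leqnSn _).
  (* Adding 1 makes a exceed all |x_j| strictly, so a and -a are simple end values; it also makes a
     positive when n = 0. *)
  pose a := bound n x + 1.
  have b0 := bound_ge0 n x.
  have yW : noninc n.+1 (set_last n x (- a)).
    by apply: noninc_set_last => //; rewrite /a; lra.
  have bnd j : (j < n)%N -> - a < x j < a.
    move=> jn; have /andP[h1 h2] := boundP xW jn; apply/andP; rewrite /a.
    by move: h1 h2; clear; move=> h1 h2; split; lra.
  pose z := push a (set_last n x (- a)).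
  have zW : noninc n.+2 z.
    move=> [|i] [|j] //= ij jn; last exact: yW.
    rewrite /set_last; case: ifPn => [/bnd/andP[_ /ltW]//|_].
    by rewrite /a; lra.
  have z0 : z 0%N = a by [].
  have zn : z n.+1 = - a by rewrite /z/= /set_last ltnn.
  have z1 : z 1%N < a.
    by rewrite /z/= /set_last; case: ifPn => [/bnd/andP[]//|_]; rewrite /a; lra.
  have zm : - a < z n.
    rewrite /z; case: (n) bnd => [|m] bnd /=; first by rewrite /a; lra.
    by rewrite /set_last ltnSn; have /andP[] := bnd m (ltnSn m).
  have zE : strict_ends n.+2 z by split; rewrite ?z0 // -pred_Sn zn subrr.
  exists z; split=> //.
  rewrite code_outer ?zn ?z0 ?subrr//; congr (_ :: _).
  by apply: eq_code => i j ilt jlt; rewrite /z /cancels /shift /= /set_last ilt jlt.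
have HG w : w \in wG n.+1 ->
    exists x, [/\ noninc n.+1 x, ends_opp n.+1 x & code n.+1 (cancels x) = w].
  rewrite wGS !mem_cat => /or3P[/mapP[u /IH_G[x [xW [n0 xn] <-] ->]]| |/HK].
  - exists (x \o predn); have yW := noninc_dupl xW.
    split=> //; case: n n0 xn xW yW {IH IH_H IH_F IH_G IH_K HK} => // n _ xn xW yW.
    by rewrite code_dupl.
  - case: n {IH IH_H IH_F IH_G IH_K HK} => // /[!inE] /eqP->.
    exists (fun=> 0); split=> //; first by split=> //=; rewrite addr0.
    by rewrite /= /cancels addr0 eqxx.
  - by move=> [x [xW /strict_ends_opp xP <-]]; exists x.
have HF w : w \in wF n.+1 ->
    exists x, [/\ noninc n.+1 x, first_matched n.+1 x & code n.+1 (cancels x) = w].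
  rewrite wFS !mem_cat => /orP[/mapP[u /IH_F[x [xW [i i_n xi] <-] ->]]|/HG].
  - have b0 := bound_ge0 n x.
    (* The new last value lies strictly below every -x_j and is nonzero, so it cancels neither an
       old coordinate nor itself. *)
    pose y := set_last n x (- (bound n x + 1)).
    have yW : noninc n.+1 y by apply: noninc_set_last => //; lra.
    have yE k : (k < n)%N -> y k = x k by rewrite /y /set_last => ->.
    have yP : first_matched n y by exists i; rewrite // !yE//; lia.
    exists y; split=> //.
      by case: yP => j jn yj; exists j; rewrite // ltnW.
    rewrite code_rgt//; last first.
      move=> j; rewrite leq_eqVlt {1}/y /set_last ltnn => /orP[/eqP->|jn].
        by rewrite /y /set_last ltnn; apply/eqP; lra.
      rewrite yE//; have /andP[_ h] := boundP xW jn.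
      by apply/eqP; move: h; clear; lra.
    congr (_ :: _); apply: eq_code => k j kn jn.
    by rewrite /cancels !yE.
  - by move=> [x [xW /ends_opp_matched xP <-]]; exists x.
split=> // w; rewrite wHS mem_cat => /orP[/mapP[u /IH_H[x [xW <-] ->]]|/HF]; last first.
  by move=> [x [xW _ <-]]; exists x.
have b0 := bound_ge0 n x.
have yW : noninc n.+1 (push (bound n x + 1) x) by apply: noninc_push => //; lra.
exists (push (bound n x + 1) x); split=> //.
rewrite code_lft// => -[|j] jn; rewrite /=; first by apply/eqP; lra.
have /andP[h _] := boundP xW jn.
by apply/eqP; move: h; clear; lra.
Qed.

End Realization.

(** * Dimensions of flats *)

Section Bases.
Variable R : realFieldType.
Implicit Types (x y : nat -> R) (S : (nat -> R) -> Prop).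

(** S is typically a cone rather than a subspace: B is a basis of its linear hull, chosen inside S,
    with only the coordinates below n taken into account. *)
Definition is_basis n S k (B : nat -> nat -> R) :=
  [/\ forall j, (j < k)%N -> S (B j),
      forall c : nat -> R, (forall i, (i < n)%N -> \sum_(j < k) c j * B j i = 0) ->
        forall j, (j < k)%N -> c j = 0 &
      forall y, S y -> exists c : nat -> R,
        forall i, (i < n)%N -> y i = \sum_(j < k) c j * B j i].

(* [r] embeds the n coordinates of the smaller problem among the n' ones of the
   larger problem, and [ext] is a (nonlinear) section of the restriction. *)
Section Lift.
Variables (n n' : nat) (S S' : (nat -> R) -> Prop) (r : nat -> nat).
Variable ext : (nat -> R) -> (nat -> R).
Hypothesis rn : forall i, (i < n)%N -> (r i < n')%N.
Hypothesis extS : forall b, S b -> S' (ext b).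
Hypothesis extE : forall b i, S b -> (i < n)%N -> ext b (r i) = b i.
Hypothesis resS : forall y, S' y -> S (y \o r).

Lemma is_basis_lift k B :
  (forall i, (i < n')%N -> exists2 i', (i' < n)%N & forall y, S' y -> y i = y (r i')) ->
  is_basis n S k B -> is_basis n' S' k (fun j => ext (B j)).
Proof.
move=> cov [SB indep gen]; split.
- by move=> j jk; apply/extS/SB.
- move=> c c0; apply: indep => i iln; rewrite -[RHS](c0 _ (rn iln)).
  by apply: eq_bigr => j _; rewrite extE//; exact: SB.
- move=> y Sy; have [c cE] := gen _ (resS Sy); exists c => i iln.
  have [i' i'n iE] := cov i iln; rewrite iE// [LHS](cE i' i'n).
  by apply: eq_bigr => j _; rewrite iE ?extE//; [exact: SB|apply/extS/SB].
Qed.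

(** The vector v spans one new direction: it vanishes on the old coordinates, and the others are
    tied to coordinate p in the proportions of v. *)
Lemma is_basis_cone k B v p : S' v -> v p != 0 -> (p < n')%N ->
  (forall i, (i < n)%N -> v (r i) = 0) ->
  (forall i, (i < n')%N -> (exists2 i', (i' < n)%N & i = r i') \/
                           (forall y, S' y -> y i = y p / v p * v i)) ->
  is_basis n S k B -> is_basis n' S' k.+1 (fun j => if j is j'.+1 then ext (B j') else v).
Proof.
move=> Sv vp pn vr cov [SB indep gen]; split.
- by move=> [|j] jk //; apply/extS/SB.
- move=> c c0.
  have cS j : (j < k)%N -> c j.+1 = 0.
    move: j; apply: (indep (c \o succn)) => i iln; rewrite -[RHS](c0 _ (rn iln)).
    rewrite big_ord_recl /= vr// mulr0 add0r.
    by apply: eq_bigr => j _; rewrite /bump ?leq0n ?add0n extE//; exact: SB.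
  move=> [_|j]; last exact: cS.
  have := c0 p pn; rewrite big_ord_recl big1 ?addr0; last first.
    by move=> j _; rewrite [nat_of_ord (lift _ _)]lift0 cS// mul0r.
  by move/eqP; rewrite mulf_eq0 (negbTE vp) orbF => /eqP.
- move=> y Sy; have [c cE] := gen _ (resS Sy).
  (* The coefficient of v corrects coordinate p for what the vectors [ext (B j)] already contribute
     there. *)
  pose c0 := (y p - \sum_(j < k) c j * ext (B j) p) / v p.
  exists (fun j => if j is j'.+1 then c j' else c0) => i iln.
  rewrite big_ord_recl /=.
  have [[i' i'n ->]|iE] := cov i iln.
    rewrite vr// mulr0 add0r [LHS](cE i' i'n).
    by apply: eq_bigr => j _; rewrite /bump ?leq0n ?add0n extE//; exact: SB.
  rewrite iE// /c0 mulrBl mulrBl addrAC -addrA -[LHS]addr0; congr (_ + _).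
  rewrite !mulr_suml -sumrB big1// => j _.
  by rewrite /bump ?leq0n ?add0n [ext _ i]iE ?mulrA ?subrr//; apply/extS/SB.
Qed.

End Lift.

Definition flat n x y :=
  noninc n y /\ forall i j, (i < n)%N -> (j < n)%N -> cancels x i j -> cancels y i j.

Lemma flat_shift n x y : flat n.+1 x y -> flat n (shift x) (shift y).
Proof. by move=> [yW xy]; split; [exact: noninc_shift|move=> i j iln jln; exact: xy]. Qed.

Lemma flat_leq m n x y : (m <= n)%N -> flat n x y -> flat m x y.
Proof.
move=> mn [yW xy]; split; first exact: noninc_leq yW.
by move=> i j im jm; apply: xy; exact: leq_trans mn.
Qed.

(** Induction along the code: [Lft], [Rgt] and [Outer] add a vector by [is_basis_cone], while [DupL]
    and [DupR] keep the size by [is_basis_lift]. *)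
Lemma flat_basis n x : noninc n x ->
  exists B, is_basis n (flat n x) (wdim (code n (cancels x))) B.
Proof.
elim/ltn_ind: n x => -[|n] IH x xW.
  by exists (fun _ _ => 0); split=> // y _; exists (fun=> 0).
have xS := noninc_shift xW; have xn := noninc_leq (leqnSn n) xW.
case: (codeP xW) => [H|i0 i0n x0i H|n0 x0|m nm x0n x01|m nm x0n x10 xnm|m nm x0n x10 xnm].
- have [B BP] := IH n (ltnSn n) _ xS.
  eexists; rewrite /wdim /= -/(wdim _).
  (* The new direction is (1, 0, ..., 0). Repeating the first entry of b stays in the chamber, and
     an unmatched x_0 imposes no equation on it. *)
  apply: (@is_basis_cone _ _ (flat n (shift x)) _ succn (fun b => b \o predn) _ _ _ _ _ _
    (fun i => (i == 0%N)%:R) 0%N _ _ _ _ _ BP) => //.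
  + move=> b [bW xb]; split; first exact: noninc_dupl.
    move=> [|i] [|j] iln jln; rewrite {1}/cancels ?[x _.+1 + x 0%N]addrC ?(negbTE (H _ _))//.
    by move=> xij; exact: xb.
  + exact: flat_shift.
  + split=> [[|i] [|j]//= ij jln|[|i] [|j] iln jln]; rewrite ?lexx//.
    * by rewrite {1}/cancels (negbTE (H _ _)).
    * by rewrite {1}/cancels (negbTE (H _ _)).
    * by rewrite {1}/cancels addrC (negbTE (H _ _)).
    * by rewrite /cancels /= addr0.
  + by rewrite /= oner_eq0.
  + move=> [|i] iln; last by left; exists i.
    by right=> y _; rewrite eqxx divr1 mulr1.
- have [B BP] := IH n (ltnSn n) _ xn.
  eexists; rewrite /wdim /= -/(wdim _).
  have n0 : (0 < n)%N by lia.
  (* The mirror case: the direction (0, ..., 0, -1), with the sign that the chamber demands. *)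
  apply: (@is_basis_cone _ _ (flat n x) _ id (fun b i => b (minn i n.-1)) _ _ _ _ _ _
    (fun i => - (i == n)%:R) n _ _ _ _ _ BP) => //.
  + by move=> i /ltnW.
  + move=> b [bW xb]; split; first exact: noninc_dupr.
    move=> i j; rewrite !ltnS leq_eqVlt => /orP[/eqP-> jn|iln].
      by rewrite {1}/cancels (negbTE (H _ _)).
    rewrite leq_eqVlt => /orP[/eqP->|jln].
      by rewrite {1}/cancels addrC (negbTE (H _ _))// ltnW.
    move=> xij; have := xb i j iln jln xij; rewrite /cancels.
    by have [-> ->] : minn i n.-1 = i /\ minn j n.-1 = j by lia.
  + by move=> b i _ iln; congr b; lia.
  + by move=> y; exact: flat_leq.
  + split=> [i j ij jln|i j]; first by rewrite lerN2 ler_nat; lia.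
    rewrite !ltnS leq_eqVlt => /orP[/eqP-> jn|iln].
      by rewrite {1}/cancels (negbTE (H _ _)).
    rewrite leq_eqVlt => /orP[/eqP->|jln].
      by rewrite {1}/cancels addrC (negbTE (H _ _))// ltnW.
    by move=> _; rewrite /cancels !ltn_eqF// oppr0 addr0.
  + by rewrite eqxx oppr_eq0 oner_eq0.
  + by move=> i iln; rewrite ltn_eqF// oppr0.
  + move=> i; rewrite ltnS leq_eqVlt => /orP[/eqP->|iln]; last by left; exists i.
    by right=> y _; rewrite eqxx divfK// oppr_eq0 oner_eq0.
- exists (fun _ _ => 0); rewrite n0; split=> // y [_ /(_ 0%N 0%N isT isT)].
  rewrite /cancels x0 addr0 eqxx => /(_ isT)/eqP y0.
  by exists (fun=> 0) => -[|//] _; rewrite big_ord0; lra.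
- have [B BP] := IH n (ltnSn n) _ xS.
  eexists; rewrite /wdim /= -/(wdim _).
  apply: (@is_basis_lift _ _ (flat n (shift x)) _ succn (fun b => b \o predn)
    _ _ _ _ _ _ _ BP) => //.
  + have E k : shift x k.-1 = x k by case: k.
    move=> b [bW xb]; split; first exact: noninc_dupl.
    move=> i j iln jln xij; apply: xb; [lia|lia|].
    by rewrite /cancels !E.
  + exact: flat_shift.
  + move=> [|i] iln; last by exists i.
    (* On the flat y_0 and y_1 are both opposite to y_n, so y_0 copies y_1, which has index 0 in the
       shifted problem. *)
    exists 0%N; first by rewrite nm.
    move=> y [_ yx]; have := yx 0%N n isT (ltnSn n); rewrite /cancels x0n eqxx => /(_ isT).
    have := yx 1%N n _ (ltnSn n); rewrite /cancels -x01 x0n eqxx nm.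
    by move=> /(_ isT isT) /eqP h1 /eqP h0; lra.
- have [B BP] := IH n (ltnSn n) _ xn.
  eexists; rewrite /wdim /= -/(wdim _).
  have n0 : (0 < n)%N by lia.
  apply: (@is_basis_lift _ _ (flat n x) _ id (fun b i => b (minn i n.-1))
    _ _ _ _ _ _ _ BP) => //.
  + by move=> i /ltnW.
  + have E k : (k < n.+1)%N -> x (minn k n.-1) = x k.
      move=> kn; have [kn'|kn'] := eqVneq k n; last by congr x; lia.
      by rewrite kn' xnm; congr x; lia.
    move=> b [bW xb]; split; first exact: noninc_dupr.
    move=> i j iln jln xij; apply: xb; [lia|lia|].
    by rewrite /cancels !E.
  + by move=> b i _ iln; congr b; lia.
  + by move=> y; exact: flat_leq.
  + move=> i; rewrite ltnS leq_eqVlt => /orP[/eqP->|iln]; last by exists i.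
    exists m; first by rewrite nm.
    move=> y [_ yx]; have := yx 0%N n isT (ltnSn n); rewrite /cancels x0n eqxx => /(_ isT).
    have := yx 0%N m isT; rewrite /cancels -xnm x0n eqxx nm.
    by move=> /(_ (ltnW (ltnSn _)) isT) /eqP h1 /eqP h0 /=; lra.
- rewrite nm in xW xS xn x0n x10 xnm IH *; rewrite {n nm}in IH *.
  have xm : noninc m (shift x) by apply: noninc_leq xS.
  have [B BP] := IH m (leqnSn _) _ xm.
  have xcorner i j : (i < m.+2)%N -> (j < m.+2)%N -> cancels x i j ->
      [\/ (0 < i < m.+1)%N /\ (0 < j < m.+1)%N, i = 0%N /\ j = m.+1 | j = 0%N /\ i = m.+1].
    move=> im jm; rewrite -(decode_code xW)// code_outer//=.
    case: ifP => [/andP[ib jb] _|_]; first by constructor 1.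
    by case/orP=> /andP[/eqP-> /eqP->]; [constructor 2|constructor 3].
  eexists; rewrite /wdim /= -/(wdim _).
  (* The new direction is (1, 0, ..., 0, -1). Surrounding b by plus and minus its [bound] suffices,
     since a flat is closed and needs no strict inequality. *)
  apply: (@is_basis_cone _ _ (flat m (shift x)) _ succn
    (fun b => push (bound m b) (set_last m b (- bound m b))) _ _ _ _ _ _
    (fun i => (i == 0%N)%:R - (i == m.+1)%:R) 0%N _ _ _ _ _ BP) => //.
  + by move=> i im; rewrite ltnS ltnW.
  + move=> b [bW xb]; have b0 := bound_ge0 m b.
    have bB : noninc m.+1 (set_last m b (- bound m b)) by apply: noninc_set_last.
    split=> [[|i] [|j]//= ij jln|i j im jm xij]; [|exact: bB|].
      rewrite /set_last; case: ifPn => [/(boundP bW)/andP[]//|_].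
      by rewrite (le_trans _ b0)// oppr_le0.
    have [[]|[-> ->]|[-> ->]] := xcorner i j im jm xij.
    * case: i im xij => // i im xij ib; case: j jm xij => // j jm xij jb.
      have [{}ib {}jb] : (i < m)%N /\ (j < m)%N by [].
      by rewrite /cancels /push /set_last ib jb; exact: xb.
    * by rewrite /cancels /= /set_last ltnn subrr.
    * by rewrite /cancels /= /set_last ltnn addrC subrr.
  + by move=> b i _ im; rewrite /= /set_last im.
  + by move=> y xy; apply: flat_leq (flat_shift xy).
  + split=> [i j ij jm|i j im jm xij]; first by rewrite lerB// ler_nat; lia.
    have [[/andP[i0 iN] /andP[j0 jN]]|[-> ->]|[-> ->]] := xcorner i j im jm xij.
    * by rewrite /cancels (gtn_eqF i0) (gtn_eqF j0) (ltn_eqF iN) (ltn_eqF jN) !subrr addr0.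
    * by rewrite /cancels !eqxx /= subr0 sub0r subrr.
    * by rewrite /cancels !eqxx /= subr0 sub0r addrC subrr.
  + by rewrite /= subr0 oner_eq0.
  + by move=> i im; rewrite /= eqSS (ltn_eqF im) subr0.
  + move=> [|i] im; first by right=> y _; rewrite eqxx /= subr0 divr1 mulr1.
    have [->|im'] := eqVneq i m; last by left; exists i => //; lia.
    right=> y [_ /(_ 0%N m.+1 isT (ltnSn _))]; rewrite /cancels x0n !eqxx => /(_ isT) /eqP y0.
    by rewrite /= subr0 sub0r divr1 mulrN1; lra.
Qed.

End Bases.

(** * Counting flats *)

(** Only finitely many conditions e |b| < |a| with a nonzero have to hold; the bound |a| / (|b| + 1)
    on e avoids dividing by zero. *)
Lemma small_perturbation (R : realFieldType) (s : seq (R * R)) :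
  exists2 e : R, 0 < e & forall p, p \in s -> p.1 != 0 -> p.1 + e * p.2 != 0.
Proof.
suff [e e0 es] : exists2 e : R, 0 < e &
    forall p, p \in s -> p.1 != 0 -> e * `|p.2| < `|p.1|.
  exists e => // p ps p0; have := es p ps p0; apply: contraTneq => /eqP.
  rewrite addr_eq0 => /eqP->; rewrite normrN normrM (gtr0_norm e0).
  by rewrite ltxx.
elim: s => [|[a b] s [e e0 es]]; first by exists 1.
have [->|a0] := eqVneq a 0.
  by exists e => // p; rewrite inE => /orP[/eqP->/=|/es//]; rewrite eqxx.
have b1 : 0 < `|b| + 1 by rewrite ltr_wpDl.
exists (Num.min e (`|a| / (`|b| + 1))).
  by rewrite lt_min e0 divr_gt0// normr_gt0.
move=> p; rewrite inE => /orP[/eqP-> _ /=|ps p0].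
  apply: (@le_lt_trans _ _ (`|a| / (`|b| + 1) * `|b|)).
    by rewrite ler_wpM2r// ge_min lexx orbT.
  rewrite mulrAC ltr_pdivrMr// ltr_pM2l ?normr_gt0//.
  by rewrite ltrDl.
apply: le_lt_trans (es p ps p0).
by rewrite ler_wpM2r// ge_min lexx.
Qed.

Section Bridge.
Variables (R : realType) (n : nat).
Implicit Types (x y : 'rV[R]_n) (f g : nat -> R) (T : {set 'I_n * 'I_n}).

Definition coord x : nat -> R := fun i => oapp (fun k => x 0 k) 0 (insub i).

Lemma coordE x (i : 'I_n) : coord x i = x 0 i.
Proof. by rewrite /coord valK. Qed.

Lemma coord_row f i : (i < n)%N -> coord (\row_k f k) i = f i.
Proof. by move=> iln; rewrite (coordE _ (Ordinal iln)) mxE. Qed.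

(** On the diagonal, x_i = 0 and 2 x_i = 0 agree in characteristic zero. *)
Lemma hypE (i j : 'I_n) x : hyp i j x <-> x 0 i + x 0 j = 0.
Proof.
rewrite /hyp /=; case: eqP => [<-|_] //.
by split=> [->|/eqP]; rewrite ?addr0// -mulr2n mulrn_eq0 => /eqP.
Qed.

Lemma weylE x : weyl_chamber x <-> noninc n (coord x).
Proof.
split=> xW i j ij.
  move=> jn; have iln := leq_ltn_trans ij jn.
  by rewrite (coordE _ (Ordinal iln)) (coordE _ (Ordinal jn)); exact: xW.
by rewrite -!coordE; apply: xW.
Qed.

Definition pairs_of (t : rel nat) : {set 'I_n * 'I_n} :=
  [set p : 'I_n * 'I_n | (p.1 <= p.2)%N && t p.1 p.2].

Lemma admissible_pairs_of t : admissible (pairs_of t).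
Proof. by apply/forall_inP => p; rewrite inE => /andP[]. Qed.

Lemma flat_of_pairsE f x : flat_of (pairs_of (cancels f)) x <-> flat n f (coord x).
Proof.
split=> [[/weylE xW xT]|[xW fx]]; split=> //; last 2 first.
- exact/weylE.
- move=> p; rewrite inE => /andP[pp fp]; apply/hypE/eqP.
  by rewrite -!coordE; exact: (fx p.1 p.2 (ltn_ord _) (ltn_ord _)).
move=> i j iln jln fij.
wlog ij : i j iln jln fij / (i <= j)%N => [W|].
  have [|/ltnW] := leqP i j; first exact: W.
  by rewrite cancelsC; apply: W => //; rewrite cancelsC.
have /hypE : hyp (Ordinal iln) (Ordinal jln) x.
  by apply: (xT (Ordinal iln, Ordinal jln)); rewrite inE /= ij.
by rewrite -!coordE /cancels /= => ->.
Qed.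

(* A point of the flat with as few vanishing x_i + x_j as possible: moving it
   slightly towards any y of the flat cannot create a zero, so y satisfies every
   equation it satisfies. *)
Lemma generic_point T : admissible T ->
  exists f, noninc n f /\ flat_of (R := R) T = flat_of (pairs_of (cancels f)).
Proof.
move=> adm.
have Pex : exists m, `[< exists x, flat_of T x /\ #|pairs_of (cancels (coord x))| = m >].
  exists #|pairs_of (cancels (coord 0))|; apply/asboolP; exists 0; split=> //.
  split=> [i j _|p _]; first by rewrite !mxE.
  by apply/hypE; rewrite !mxE addr0.
case: (ex_minnP Pex) => m /asboolP[x [xT xm]] mmin.
exists (coord x); split; first by apply/weylE; case: xT.
apply/seteqP; split=> y; last first.
  move=> /flat_of_pairsE[yW xy]; split; first exact/weylE.
  move=> p pT; apply/hypE/eqP; rewrite -!coordE; apply: xy => //.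
  by case: xT => _ /(_ p pT)/hypE xp; rewrite /cancels !coordE xp.
move=> yT; apply/flat_of_pairsE; split; first by apply/weylE; case: yT.
move=> i j iln jln.
wlog ij : i j iln jln / (i <= j)%N => [W|].
  have [|/ltnW] := leqP i j; first exact: W.
  by rewrite ![cancels _ i _]cancelsC; apply: W.
apply: contraTT => yij.
pose val2 (z : 'rV[R]_n) (p : 'I_n * 'I_n) : R := z 0 p.1 + z 0 p.2.
have [e e0 eP] := small_perturbation [seq (val2 x p, val2 y p) | p <- enum {: 'I_n * 'I_n}].
have {}eP p : val2 x p != 0 -> val2 x p + e * val2 y p != 0.
  by apply: (eP (val2 x p, val2 y p)); apply/mapP; exists p; rewrite ?mem_enum.
pose z : 'rV[R]_n := x + e *: y.
have zE p : val2 z p = val2 x p + e * val2 y p by rewrite /val2 !mxE; ring.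
have cE u (p : 'I_n * 'I_n) : cancels (coord u) p.1 p.2 = (val2 u p == 0).
  by rewrite /cancels !coordE.
have zT : flat_of T z.
  case: xT yT => xW xT [yW yT]; split=> [a b ab|p pT].
    by rewrite !mxE lerD ?ler_wpM2l ?(ltW e0)//; [exact: xW|exact: yW].
  apply/hypE; rewrite -/(val2 z p) zE; move/hypE: (xT p pT); move/hypE: (yT p pT).
  by rewrite /val2 => -> ->; rewrite mulr0 addr0.
have zx : pairs_of (cancels (coord z)) \subset pairs_of (cancels (coord x)).
  apply/fintype.subsetP => p; rewrite !inE !cE => /andP[-> /=].
  by apply: contraTT => /eP; rewrite zE.
apply/negP => xij.
have : (m <= #|pairs_of (cancels (coord z))|)%N.
  by apply: mmin; apply/asboolP; exists z.
rewrite -xm.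
rewrite leqNgt proper_card// properE zx; apply/fintype.subsetPn.
pose p := (Ordinal iln, Ordinal jln).
have px : val2 x p == 0 by rewrite -cE.
exists p; first by rewrite inE ij cE.
rewrite inE ij cE zE (eqP px) add0r mulf_eq0 negb_or (gt_eqF e0) /=.
by rewrite -cE.
Qed.

(** The span of the vectors of B contains the flat, and any subspace containing the flat contains
    these vectors, because they lie in it. *)
Lemma span_dim_basis f k B : is_basis n (flat n f) k B ->
  span_dim (flat_of (R := R) (pairs_of (cancels f))) = k.
Proof.
move=> [SB indep gen].
pose X := [tuple (\row_i B j i : 'rV[R]_n) | j < k].
have XE (j : 'I_k) : X`_j = \row_i B j i by rewrite -tnth_nth tnth_mktuple.
have Xfree : free X.
  apply/freeP => c c0 j.
  pose c' (i : nat) := oapp c 0 (insub i).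
  have c'E (i : 'I_k) : c' i = c i by rewrite /c' valK.
  rewrite -c'E; apply: indep => // i iln.
  have /rowP/(_ (Ordinal iln)) := c0; rewrite !mxE summxE => {2}<-.
  by apply: eq_bigr => a _; rewrite XE !mxE c'E.
have Xdim : \dim <<X>> = k by rewrite (eqP Xfree) size_tuple.
rewrite /span_dim; case: ex_minnP => m /asboolP[U [SU Um]] mmin.
apply/eqP; rewrite eqn_leq; apply/andP; split.
  apply: mmin; apply/asboolP; exists <<X>>%VS; split=> // x /flat_of_pairsE/gen[c cE].
  have -> : x = \sum_(j < k) c j *: X`_j.
    apply/rowP => i; rewrite summxE -coordE cE//.
    by apply: eq_bigr => j _; rewrite XE !mxE.
  apply: memv_suml => j _; apply/memvZ/memv_span/mem_nth.
  by rewrite size_tuple.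
rewrite -Um -{1}Xdim; apply/dimvS/span_subvP => v /(nthP 0)[j].
rewrite size_tuple => jk <-; rewrite (XE (Ordinal jk)) /=.
apply: SU; apply/flat_of_pairsE; have [bW fb] := SB j jk; split.
  move=> a b ab bn; rewrite !coord_row//; first exact: bW.
  exact: leq_ltn_trans bn.
by move=> a b an bn /(fb a b an bn); rewrite /cancels !coord_row.
Qed.

Lemma pairs_of_decode f : noninc n f ->
  pairs_of (decode (code n (cancels f)) n) = pairs_of (cancels f).
Proof. by move=> fW; apply/setP => p; rewrite !inE decode_code. Qed.

(** Each point lies on its own flat, so equal flats make f and g satisfy each other's equations and
    the patterns coincide. *)
Lemma flat_of_inj f g : noninc n f -> noninc n g ->
  flat_of (R := R) (pairs_of (cancels f)) = flat_of (pairs_of (cancels g)) ->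
  code n (cancels f) = code n (cancels g).
Proof.
have sub f1 g1 : noninc n f1 ->
    flat_of (R := R) (pairs_of (cancels f1)) = flat_of (pairs_of (cancels g1)) ->
    forall i j, (i < n)%N -> (j < n)%N -> cancels g1 i j -> cancels f1 i j.
  move=> fW fg i j iln jln.
  suff /flat_of_pairsE[_ /(_ i j iln jln)] :
      flat_of (pairs_of (cancels g1)) (\row_i f1 i : 'rV[R]_n).
    by rewrite /cancels !coord_row.
  rewrite -fg; apply/flat_of_pairsE; split=> [a b ab bn|a b an bn].
    by rewrite !coord_row//; [exact: fW|exact: leq_ltn_trans bn].
  by rewrite /cancels !coord_row.
move=> fW gW fg; apply: eq_code => i j iln jln.
by apply/idP/idP; apply: sub.
Qed.

(** [F] is a bijection from words to flats: injective by [flat_of_inj], surjective by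
    [generic_point] and [mem_code], and it carries [wdim] to the dimension of the span. *)
Lemma hE k : h R n k = count (fun w => wdim w == k) (wH n).
Proof.
pose F w : set 'rV[R]_n := flat_of (pairs_of (decode w n)).
have [real _ _ _] := code_realized R n.
have FE w : w \in wH n -> exists f, [/\ noninc n f, code n (cancels f) = w &
    F w = flat_of (pairs_of (cancels f))].
  move=> /real[f [fW fw]]; exists f; split=> //.
  by rewrite /F -fw pairs_of_decode.
have Fdim f : noninc n f ->
    span_dim (flat_of (R := R) (pairs_of (cancels f))) = wdim (code n (cancels f)).
  by move=> /flat_basis[B]; exact: span_dim_basis.
rewrite -size_filter -(size_map F); apply/eqP.
rewrite /h -(@uniq_size_uniq _ [seq F w | w <- wH n & wdim w == k]).
- exact: undup_uniq.
- rewrite map_inj_in_uniq ?filter_uniq//; first by have [] := uniq_words n.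
  move=> v w; rewrite !mem_filter => /andP[_ /FE[f [fW <- ->]]] /andP[_ /FE[g [gW <- ->]]].
  exact: flat_of_inj.
- move=> S; rewrite mem_undup; apply/mapP/mapP => -[].
    move=> w; rewrite mem_filter => /andP[wk /FE[f [fW fw ->]]] ->.
    exists (pairs_of (cancels f)) => //.
    by rewrite mem_filter Fdim// fw wk mem_enum inE; exact: admissible_pairs_of.
  move=> T; rewrite mem_filter mem_enum => /andP[Tk /set_mem/generic_point[f [fW fT]]] ->.
  exists (code n (cancels f)); last by rewrite /F pairs_of_decode.
  by rewrite mem_filter -Fdim// -fT Tk; have [] := mem_code fW.
Qed.

End Bridge.

(** * Generating functions *)

Section PowerSeries.
Implicit Types f g : ps.

(** Multiplication by the monomial s^a t^b. *)
Definition psshift a b f : ps := fun n k =>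
  if (a <= n)%N && (b <= k)%N then f (n - a)%N (k - b)%N else 0.

Definition psone : ps := fun n k => ((n == 0%N) && (k == 0%N))%:Z.

Lemma psshiftS a b c d f n k :
  psshift a b (psshift c d f) n k = psshift (a + c) (b + d) f n k.
Proof.
rewrite /psshift; case: ifP => [/andP[an bk]|ab]; last first.
  by case: ifP => // h; move: ab; rewrite (_ : _ && _) //; lia.
have -> : ((c <= n - a) && (d <= k - b) = (a + c <= n) && (b + d <= k))%N by lia.
by rewrite !subnDA.
Qed.

Lemma psmul_poly2 (l : seq (int * nat * nat)) f n k :
  psmul (poly2 l) f n k = \sum_(m <- l) m.1.1 * psshift m.1.2 m.2 f n k.
Proof.
rewrite /psmul /poly2.
under eq_bigr => a _ do under eq_bigr => b _ do rewrite big_mkcond mulr_suml.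
under eq_bigr => a _ do rewrite exchange_big /=.
rewrite exchange_big /=; apply: eq_bigr => -[[c p] q] _ /=; rewrite /psshift.
case: ifPn => [/andP[pn qk]|pq].
  rewrite (bigD1 (Ordinal (pn : (p < n.+1)%N)))//= [X in _ + X]big1 ?addr0; last first.
    move=> a ap; apply: big1 => b _; case: eqP => [pa|_]; last by rewrite mul0r.
    by case/eqP: ap; apply: val_inj.
  rewrite (bigD1 (Ordinal (qk : (q < k.+1)%N)))//= [X in _ + X]big1 ?addr0 ?eqxx//.
  move=> b bq; case: eqP => [qb|_]; last by rewrite mul0r.
  by case/eqP: bq; apply: val_inj.
rewrite mulr0; apply: big1 => a _; apply: big1 => b _.
case: ifP => [/andP[/eqP pa /eqP qb]|_]; last by rewrite mul0r.
by case/negP: pq; rewrite pa qb !leq_ord.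
Qed.

Definition gf (s : nat -> seq (seq letter)) : ps :=
  fun n k => (count (fun w => wdim w == k) (s n))%:Z.

Lemma count_cons_free (a : letter) s k : a \in [:: Lft; Rgt; Outer] ->
  count (fun w => wdim w == k) (map (cons a) s) =
    if k is k'.+1 then count (fun w => wdim w == k') s else 0%N.
Proof.
move=> aP; rewrite count_map; case: k => [|k].
  by rewrite (eq_count (a2 := pred0)) ?count_pred0// => w; rewrite /= /wdim /= aP.
by apply: eq_count => w; rewrite /= /wdim /= aP.
Qed.

Lemma count_cons_tied (a : letter) s k : a \notin [:: Lft; Rgt; Outer] ->
  count (fun w => wdim w == k) (map (cons a) s) = count (fun w => wdim w == k) s.
Proof.
by move=> /negbTE aP; rewrite count_map; apply: eq_count => w; rewrite /= /wdim /= aP.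
Qed.

(** Sorting words by first letter gives this functional equation and the next three; the constant 1
    is the empty word. *)
Lemma gf_wH n k : gf wH n k = psone n k + psshift 1 1 (gf wH) n k + gf wF n k.
Proof.
rewrite /gf /psone /psshift; case: n => [|n].
  by case: k => [|k].
rewrite wHS count_cat count_cons_free// subn1.
by case: k => [|k]; rewrite ?subn1 /= add0r ?add0r// PoszD.
Qed.

Lemma gf_wF n k : gf wF n k = psshift 1 1 (gf wF) n k + gf wG n k.
Proof.
rewrite /gf /psshift; case: n => [|n]; first by [].
rewrite wFS count_cat count_cons_free// subn1.
by case: k => [|k]; rewrite ?subn1 /= ?add0r// PoszD.
Qed.

Lemma gf_wG n k :
  gf wG n k = psshift 1 0 (gf wG) n k + psshift 1 0 psone n k + gf wK n k.
Proof.
rewrite /gf /psshift /psone; case: n => [|n]; first by [].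
rewrite wGS !count_cat count_cons_tied// subn1 subn0 /= !PoszD addrA.
by congr (_ + _ + _); case: n => [|n]; case: k.
Qed.

Lemma gf_wK n k : gf wK n k = psshift 1 0 (gf wK) n k + psshift 2 1 (gf wH) n k.
Proof.
rewrite /gf /psshift; case: n => [|[|n]]; [by []|by []|].
rewrite wKSS count_cat count_cons_tied// count_cons_free// subn1 subn0 subn2 /=.
by case: k => [|k]; rewrite ?subn1 /= PoszD.
Qed.

(** Monomial multiples of the functional equations turn the elimination into linear arithmetic on
    coefficients. *)
Lemma psshift_gf_wH a b n k : psshift a b (gf wH) n k =
  psshift a b psone n k + psshift (a + 1) (b + 1) (gf wH) n k + psshift a b (gf wF) n k.
Proof.
by rewrite -psshiftS [LHS]/psshift gf_wH /psshift; case: ifP.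
Qed.

Lemma psshift_gf_wF a b n k : psshift a b (gf wF) n k =
  psshift (a + 1) (b + 1) (gf wF) n k + psshift a b (gf wG) n k.
Proof. by rewrite -psshiftS [LHS]/psshift gf_wF /psshift; case: ifP. Qed.

Lemma psshift_gf_wG a b n k : psshift a b (gf wG) n k =
  psshift (a + 1) (b + 0) (gf wG) n k + psshift (a + 1) (b + 0) psone n k
  + psshift a b (gf wK) n k.
Proof. by rewrite -!psshiftS [LHS]/psshift gf_wG /psshift; case: ifP. Qed.

Lemma psshift_gf_wK a b n k : psshift a b (gf wK) n k =
  psshift (a + 1) (b + 0) (gf wK) n k + psshift (a + 2) (b + 1) (gf wH) n k.
Proof. by rewrite -!psshiftS [LHS]/psshift gf_wK /psshift; case: ifP. Qed.

Lemma psshift_num2 a b n k : psshift a b num2 n k =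
  psshift a b psone n k - psshift (a + 1) (b + 1) psone n k
  + psshift (a + 2) (b + 1) psone n k.
Proof.
have num2E n' k' : num2 n' k' =
    psone n' k' - psshift 1 1 psone n' k' + psshift 2 1 psone n' k'.
  rewrite /num2 /poly2 !big_cons big_nil /psone /psshift /=.
  by case: n' => [|[|[|n']]]; case: k' => [|[|k']].
by rewrite -!psshiftS [LHS]/psshift num2E /psshift; case: ifP.
Qed.

End PowerSeries.

(* H(s,t) = (1-s)(1-st+s^2t) / den(s,t) as formal power series, stated as
   den * H = (1-s) * (1-st+s^2t) (den has constant term 1, hence is invertible). *)
Theorem theorem1p10 (R : realType) :
  psmul den (fun n k => ((h R n k)%:Z)) = psmul num1 num2.
Proof.
have -> : (fun n k => (h R n k)%:Z) = gf wH.
  by apply/funext => n; apply/funext => k; rewrite hE.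
apply/funext => n; apply/funext => k.
rewrite !psmul_poly2 !big_cons !big_nil /= !psshift_num2 !addn1 !addn2.
have H a b := psshift_gf_wH a b n k; have F a b := psshift_gf_wF a b n k.
have G a b := psshift_gf_wG a b n k; have K a b := psshift_gf_wK a b n k.
(* The shifts are the monomials of the multipliers (1-s)^2(1-st) for H, (1-s)^2 for F, 1-s for G and
   1 for K. They leave ((1-s)^2(1-st)^2 - s^2 t) H = (1-s)^2(1-st) + s(1-s), whose sides are [den]
   times H and [num1] times [num2]. *)
have := (H 0 0, H 1 0, H 2 0, H 1 1, H 2 1, H 3 1)%N.
have := (F 0 0, F 1 0, F 2 0)%N.
have := (G 0 0, G 1 0)%N.
have := K 0%N 0%N.
rewrite !addn0 !addn1 !addn2 => e1 [e2 e3] [[e4 e5] e6] [[[[[e7 e8] e9] e10] e11] e12].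
lra.
Qed.
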